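(* Consider a network with $n$ cells (as defined in the context) whose turning-rate matrix $P=\{p_{i,j}\}$ is strictly upper triangular and which satisfies the demand assumption, the outflow assumption and the accommodation assumption. Assume that there exist a point $x^*=(x_1^*,\dots,x_n^* )'\in S$ with $x_i^*\in(0,\mu_i)$ for $i=1,\dots,n$ and a vector $v^*=(v_1^*,\dots,v_n^* )'\in\mathbb{R}_+^n$ with $v_i^*<\min\big(v_i^{\max},\min\{g_i(d,0):d\in D\}\big)$ for $i=1,\dots,n$, such that $$f_i(d,x_i^* )=v_i^*+\sum_{j=1}^n p_{j,i}f_j(d,x_j^* )\quad\text{for all } i=1,\dots,n \text{ and } d\in D.$$ Then there exist an index set $R\subseteq\{i\in\{1,\dots,n\}:v_i^*>0\}$, a matrix $K\in\mathbb{R}_+^{n\times n}$ and a vector $b\in\mathbb{R}_+^n$ with $0<b_i<v_i^*$ for $i\in R$ and $b_i=v_i^*$ for $i\notin R$, such that for every $\tau\in(0,1)$ the point $x^*$ is Robustly Globally Exponentially Stable for the closed-loop system obtained from the network by applying the feedback law $$v=v^*-\mathrm{diag}(v^*-b)\big(1_n-h(1_n-\tau^{-1}K\,h(x-x^* ))\big).$$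
   Context: Notation: $\mathbb{R}_+=[0,+\infty)$; $1_n=(1,\dots,1)'\in\mathbb{R}^n$; a prime denotes transpose; vector inequalities $x\le y$ are componentwise; $|x|$ is the Euclidean norm; $\mathrm{diag}(y)$ is the diagonal matrix with diagonal $y$. The map $h:\mathbb{R}^n\to\mathbb{R}_+^n$ is $h(x)=(\max(0,x_1),\dots,\max(0,x_n))'$. A matrix is strictly upper triangular if all entries on and below the main diagonal are zero. Network. The data are: constants $a_i>0$ ($i=1,\dots,n$) and $S=[0,a_1]\times\cdots\times[0,a_n]$; a non-empty compact set $D\subseteq\mathbb{R}^l$; functions $f_i:D\times[0,a_i]\to\mathbb{R}_+$ with $f_i(d,x_i)\le x_i$; functions $s_i,w_i:D\times S\times\mathbb{R}_+^n\to[0,1]$; constants $p_{i,j}\ge0$ with $p_{i,i}=0$ and $Q_i\ge0$ with $\sum_{j=1}^n p_{i,j}+Q_i=1$ for all $i$; continuous functions $g_i:D\times S\to\mathbb{R}_+$ with $0<g_i(d,x)\le a_i-x_i$ for all $(d,x)\in D\times S$ with $x_i<a_i$. It is assumed that $$w_i(d,x,v)v_i+\sum_{j=1}^n p_{j,i}s_j(d,x,v)f_j(d,x_j)\le g_i(d,x)\quad\text{for all } i \text{ and all } (d,x,v)\in D\times S\times\mathbb{R}_+^n,$$ and that if $v_i+\sum_{j=1}^n p_{j,i}f_j(d,x_j)\le g_i(d,x)$ for all $i=1,\dots,n$, then $w_i(d,x,v)=s_i(d,x,v)=1$ for all $i=1,\dots,n$. The network is the uncertain discrete-time system with state $x\in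 S$, uncertainty $d\in D$ and external inflow $v\in\mathbb{R}_+^n$: $$x_i^+=x_i+w_i(d,x,v)v_i-s_i(d,x,v)f_i(d,x_i)+\sum_{j=1}^n p_{j,i}s_j(d,x,v)f_j(d,x_j),\quad i=1,\dots,n,$$ where $x^+$ denotes the state at the next time instant. Demand assumption. For each $i$: for each $d\in D$, $0<f_i(d,z)<z$ for all $z\in(0,a_i]$. There is $\delta_i\in(0,a_i]$ such that for each $d\in D$ the function $f_i(d,\cdot)$ is continuous and increasing on $[0,\delta_i]$. There are constants $L_i\in(0,1)$, $G_i\in(0,1]$, $\tilde\delta_i\in(0,\delta_i]$ such that $|f_i(d,z)-f_i(d,y)|\ge L_i|z-y|$ for all $d\in D$, $y,z\in[0,\tilde\delta_i]$, and $|f_i(d,z)-f_i(d,y)|\le G_i|z-y|$ for all $d\in D$, $y,z\in[0,\delta_i]$. There is $f_i^{\min}>0$ with $f_i(d,z)\ge f_i^{\min}$ for all $d\in D$, $z\in[\delta_i,a_i]$. Outflow assumption. There are continuous functions $\tilde s_i:D\times S\times\mathbb{R}_+^n\to[0,1]$ with $s_i\ge\tilde s_i$ everywhere ($i=1,\dots,n$) and constants $v_i^{\max}>0$ such that: if $x_i\tilde s_i(d,x,v)=0$ and $v_i<v_i^{\max}$ for all $i=1,\dots,n$, then $x=0$. Accommodation assumption. There are constants $\mu_i\in(0,\tilde\delta_i)$ such that, with the same constants $v_i^{\max}>0$, $v_i^{\max}+\sum_{j=1}^n p_{j,i}f_j(d,x_j)\le g_i(d,x)$ for all $i=1,\dots,n$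 and all $(d,x)\in D\times S$ with $x\le\mu=(\mu_1,\dots,\mu_n)'$. Robust Global Exponential Stability (RGES). For a system $z^+=F(d,z)$, $z\in X$, $d\in D$, with $F:D\times X\to X$ and an equilibrium $z^*\in X$ (i.e. $z^*=F(d,z^* )$ for all $d\in D$), $z^*$ is Robustly Globally Exponentially Stable if there exist constants $M,\sigma>0$ such that for every $z_0\in X$ and every sequence $\{d(t)\in D\}_{t=0}^\infty$, the solution of $z(t+1)=F(d(t),z(t))$, $z(0)=z_0$, satisfies $|z(t)-z^*|\le M\exp(-\sigma t)|z_0-z^*|$ for all $t\ge0$. *)

(* Defs.v *)
From HB Require Import structures.
From mathcomp Require Import all_boot all_order all_algebra.
From mathcomp Require Import all_classical all_reals all_analysis.
Set Implicit Arguments.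
Unset Strict Implicit.
Unset Printing Implicit Defensive.
Import Order.TTheory GRing.Theory Num.Theory.
Import numFieldNormedType.Exports.
Local Open Scope classical_set_scope.
Local Open Scope ring_scope.

Section Vectors.
Context {R : realType}.

(* The library norm on 'cV[R]_n is the sup norm, hence this definition. *)
Definition enorm {n : nat} (x : 'cV[R]_n) : R :=
  Num.sqrt (\sum_(i < n) x i 0 ^+ 2).

Definition nonneg {n : nat} : set 'cV[R]_n := [set v | forall i, 0 <= v i 0].

Definition box {n : nat} (a : 'I_n -> R) : set 'cV[R]_n :=
  [set x | forall i, 0 <= x i 0 <= a i].

Definition pospart {n : nat} (x : 'cV[R]_n) : 'cV[R]_n :=
  map_mx (Num.max 0) x.

Definition strictly_upper_triangular {n : nat} (A : 'M[R]_n) : Prop :=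
  forall i j : 'I_n, (j <= i)%N -> A i j = 0.

End Vectors.

(* Functions whose domain in the mathematics is a subset (D, S, [0, a_i], the
   nonnegative orthant) are total functions here, and every condition on them is
   restricted to that domain. *)
Record network (R : realType) (l n : nat) := Network {
  cap : 'I_n -> R;
  unc : set 'cV[R]_l;
  demand : 'I_n -> 'cV[R]_l -> R -> R;
  sfun : 'I_n -> 'cV[R]_l -> 'cV[R]_n -> 'cV[R]_n -> R;
  wfun : 'I_n -> 'cV[R]_l -> 'cV[R]_n -> 'cV[R]_n -> R;
  turn : 'M[R]_n;
  exitrate : 'I_n -> R;
  supply : 'I_n -> 'cV[R]_l -> 'cV[R]_n -> R;
  cap_gt0 : forall i, 0 < cap i;
  unc_neq0 : unc !=set0;
  unc_compact : compact unc;
  demand_bounds : forall i d z, unc d -> 0 <= z <= cap i ->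
    0 <= demand i d z <= z;
  sfun_bounds : forall i d x v, unc d -> box cap x -> nonneg v ->
    0 <= sfun i d x v <= 1;
  wfun_bounds : forall i d x v, unc d -> box cap x -> nonneg v ->
    0 <= wfun i d x v <= 1;
  turn_ge0 : forall i j, 0 <= turn i j;
  turn_diag : forall i, turn i i = 0;
  exitrate_ge0 : forall i, 0 <= exitrate i;
  turn_exit : forall i, \sum_(j < n) turn i j + exitrate i = 1;
  supply_continuous : forall i,
    {within unc `*` box cap, continuous (fun q => supply i q.1 q.2)};
  supply_ge0 : forall i d x, unc d -> box cap x -> 0 <= supply i d x;
  supply_bounds : forall i d x, unc d -> box cap x -> x i 0 < cap i ->
    0 < supply i d x <= cap i - x i 0;
  inflow_le_supply : forall i d x v, unc d -> box cap x -> nonneg v ->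
    wfun i d x v * v i 0
      + \sum_(j < n) turn j i * sfun j d x v * demand j d (x j 0)
      <= supply i d x;
  uncongested : forall d x v, unc d -> box cap x -> nonneg v ->
    (forall i, v i 0 + \sum_(j < n) turn j i * demand j d (x j 0)
                 <= supply i d x) ->
    forall i, wfun i d x v = 1 /\ sfun i d x v = 1
}.

Section Network.
Context {R : realType} {l n : nat}.
Implicit Types (N : network R l n).

Definition states N : set 'cV[R]_n := box (cap N).

Definition network_step N (d : 'cV[R]_l) (x v : 'cV[R]_n) : 'cV[R]_n :=
  \col_(i < n) (x i 0 + wfun N i d x v * v i 0
                - sfun N i d x v * demand N i d (x i 0)
                + \sum_(j < n) turn N j i * sfun N j d x v
                                 * demand N j d (x j 0)).

Definition closed_loop N (k : 'cV[R]_n -> 'cV[R]_n)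
    (d : 'cV[R]_l) (x : 'cV[R]_n) : 'cV[R]_n :=
  network_step N d x (k x).

(* delta i and deltat i are the constants delta_i and \tilde delta_i; the latter
   also enters the accommodation assumption. *)
Definition demand_assumption N (delta deltat : 'I_n -> R) : Prop :=
  forall i,
    (forall d z, unc N d -> 0 < z <= cap N i -> 0 < demand N i d z < z) /\
    0 < delta i <= cap N i /\
    (forall d, unc N d ->
       {within [set z : R | 0 <= z <= delta i], continuous (demand N i d)} /\
       (forall y z, 0 <= y -> y < z -> z <= delta i ->
          demand N i d y < demand N i d z)) /\
    0 < deltat i <= delta i /\
    (exists L : R, 0 < L < 1 /\
       forall d y z, unc N d -> 0 <= y <= deltat i -> 0 <= z <= deltat i ->
         L * `|z - y| <= `|demand N i d z - demand N i d y|) /\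
    (exists G : R, 0 < G <= 1 /\
       forall d y z, unc N d -> 0 <= y <= delta i -> 0 <= z <= delta i ->
         `|demand N i d z - demand N i d y| <= G * `|z - y|) /\
    (exists fmin : R, 0 < fmin /\
       forall d z, unc N d -> delta i <= z <= cap N i -> fmin <= demand N i d z).

Definition outflow_assumption N (vmax : 'I_n -> R) : Prop :=
  (forall i, 0 < vmax i) /\
  exists st : 'I_n -> 'cV[R]_l -> 'cV[R]_n -> 'cV[R]_n -> R,
    (forall i, {within (unc N `*` states N) `*` nonneg,
                  continuous (fun q => st i q.1.1 q.1.2 q.2)}) /\
    (forall i d x v, unc N d -> states N x -> nonneg v ->
       0 <= st i d x v <= 1 /\ st i d x v <= sfun N i d x v) /\
    (forall d x v, unc N d -> states N x -> nonneg v ->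
       (forall i, x i 0 * st i d x v = 0 /\ v i 0 < vmax i) -> x = 0).

Definition accommodation_assumption N (deltat vmax mu : 'I_n -> R) : Prop :=
  (forall i, 0 < mu i < deltat i) /\
  forall d x, unc N d -> states N x -> (forall i, x i 0 <= mu i) ->
    forall i, vmax i + \sum_(j < n) turn N j i * demand N j d (x j 0)
                <= supply N i d x.

Definition feedback (vstar b xstar : 'cV[R]_n) (K : 'M[R]_n) (tau : R)
    (x : 'cV[R]_n) : 'cV[R]_n :=
  let one := const_mx 1 : 'cV[R]_n in
  vstar - diag_mx (vstar - b)^T
            *m (one - pospart (one - tau^-1 *: (K *m pospart (x - xstar)))).

End Network.

(* Since F is a total function here, F mapping D x X to X is part of the
   property, as is z* being an equilibrium in X. *)
Definition RGES {R : realType} {l n : nat} (D : set 'cV[R]_l) (X : set 'cV[R]_n)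
    (F : 'cV[R]_l -> 'cV[R]_n -> 'cV[R]_n) (zstar : 'cV[R]_n) : Prop :=
  (forall d z, D d -> X z -> X (F d z)) /\
  X zstar /\ (forall d, D d -> F d zstar = zstar) /\
  exists M sigma : R, 0 < M /\ 0 < sigma /\
    forall (d : nat -> 'cV[R]_l) (z : nat -> 'cV[R]_n),
      (forall t, D (d t)) -> X (z 0%N) ->
      (forall t, z t.+1 = F (d t) (z t)) ->
      forall t, enorm (z t - zstar)
                  <= M * expR (- sigma * t%:R) * enorm (z 0%N - zstar).

(* Main.v *)
(** Fix [L < 1] below all the lower slopes of the demand functions near [0],
    let [theta = L / 2], and weight cell [i] by [theta ^+ i].  As the turning
    matrix is strictly upper triangular with row sums at most [1], the weighted
    flow that a cell sends downstream is at most [theta] times its weighted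
    outflow.  Let [E x] be the weighted sum of the excesses
    [max 0 (x_i - xstar_i)], take [K] proportional to the weights, so that the
    gain is driven by [E x / eps], and take [b] to be a small multiple of [vstar].

    While [E x <= eps] the network is uncongested and monotone, so [E] contracts
    by the factor [1 - theta]; the weighted distance [W] to [xstar] contracts up
    to an error [C * E x], hence [W + B * E] contracts for [B] large.  While
    [eps < E x] the inflow is [b], and the outflow assumption together with
    compactness bounds the outflow from below, so the weighted content of the
    network drops by a fixed amount at every step. *)
Require Import Defs.
From mathcomp Require Import all_boot all_order all_algebra.
From mathcomp Require Import all_classical all_reals all_analysis.
From mathcomp Require Import ring lra.
Set Implicit Arguments.
Unset Strict Implicit.
Unset Printing Implicit Defensive.
Import Order.TTheory GRing.Theory Num.Theory.
Import numFieldNormedType.Exports.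
Local Open Scope classical_set_scope.
Local Open Scope ring_scope.

(** * Euclidean norm estimates and topological preliminaries *)

Lemma enorm_ge0 (R : realType) n (x : 'cV[R]_n) : 0 <= enorm x.
Proof. exact: sqrtr_ge0. Qed.

Lemma coord_le_enorm (R : realType) n (x : 'cV[R]_n) i : `|x i 0| <= enorm x.
Proof.
rewrite -sqrtr_sqr ler_wsqrtr // (bigD1 i) //= lerDl.
by apply: sumr_ge0 => j _; exact: sqr_ge0.
Qed.

Lemma enorm_le_sum (R : realType) n (x : 'cV[R]_n) :
  enorm x <= \sum_(i < n) `|x i 0|.
Proof.
have s0 : 0 <= \sum_(i < n) `|x i 0| by apply: sumr_ge0.
rewrite -(ler_sqr (enorm_ge0 x) s0)// /enorm sqr_sqrtr; last first.
  by apply: sumr_ge0 => i _; exact: sqr_ge0.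
rewrite [leRHS]expr2 mulr_suml; apply: ler_sum => i _.
rewrite -real_normK ?num_real// expr2 ler_wpM2l// (bigD1 i)//= lerDl.
by apply: sumr_ge0.
Qed.

Lemma trmx_continuous (R : realType) m n :
  continuous (@trmx R m n : 'M[R]_(m, n) -> 'M[R]_(n, m)).
Proof.
move=> x s /= /nbhs_ballP[e e0 es].
apply/nbhs_ballP; exists e => //= y [_ xy].
by apply: es; split=> // i j; rewrite !mxE; exact: xy.
Qed.

(** The box is the transpose of a product of segments of row vectors, to which [rV_compact]
    applies. *)
Lemma compact_box (R : realType) n (a : 'I_n -> R) : compact (box a).
Proof.
have -> : box a = trmx @`
    [set v : 'rV[R]_n | forall i, `[0, a i]%classic (v ord0 i)].
  apply/seteqP; split => [x xa|_ [v va <-] i]; last first.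
    by have /= := va i; rewrite in_itv/= mxE.
  exists x^T; last by rewrite trmxK.
  by move=> i /=; rewrite in_itv/= mxE; exact: xa.
apply: continuous_compact; last first.
  apply: (@rV_compact R n (fun i => `[0, a i]%classic)) => i.
  exact: segment_compact.
by apply: continuous_subspaceT; exact: trmx_continuous.
Qed.

(** The path [p] stays in [A] for small [t > 0], so continuity of [f] relative to [A] is enough for
    the inequality to pass to the limit. This later extends the supply bound to full cells. *)
Lemma closure_within_le (R : realType) (T : topologicalType) (A : set T)
    (f : T -> R) (p : R -> T) (h : R -> R) :
  {within A, continuous f} ->
  {for 0, continuous p} -> {for 0, continuous h} -> A (p 0) ->
  (\forall t \near 0^'+, A (p t) /\ f (p t) <= h t) -> f (p 0) <= h 0.
Proof.
move=> /subspace_continuousP fA pc hc Ap0 near0.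
have sub : p @ 0^'+ `=>` within A (nbhs (p 0)).
  move=> U UA; have pU := cvg_at_right_filter pc UA.
  rewrite /= nbhs_filterE /fmap/=.
  by apply: filterS2 near0 pU => t [At _]; exact.
apply: (@ler_cvg_to _ (0^'+) _ _ (f \o p) h).
- exact: (cvg_trans (cvg_app f sub) (fA _ Ap0)).
- exact: cvg_at_right_filter.
- by near=> t; have [] : A (p t) /\ f (p t) <= h t by near: t.
Unshelve. all: by end_near. Qed.


(** * Lyapunov criteria for robust exponential stability *)

(** Iterating the decrease gives [Phi (z t) <= lam ^+ t * Phi (z 0)]; the two-sided bound on [Phi]
    then yields overshoot [c2 / c1] and rate [- ln lam]. *)
Lemma lyapunov_RGES (R : realType) l n (D : set 'cV[R]_l) (X : set 'cV[R]_n)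
    (F : 'cV[R]_l -> 'cV[R]_n -> 'cV[R]_n) zs (Phi : 'cV[R]_n -> R) c1 c2 lam :
  (forall d z, D d -> X z -> X (F d z)) -> X zs ->
  (forall d, D d -> F d zs = zs) ->
  0 < c1 -> 0 < c2 -> 0 < lam < 1 ->
  (forall z, X z -> c1 * enorm (z - zs) <= Phi z <= c2 * enorm (z - zs)) ->
  (forall d z, D d -> X z -> Phi (F d z) <= lam * Phi z) ->
  RGES D X F zs.
Proof.
move=> XF Xzs Fzs c1_gt0 c2_gt0 /[dup] lam01 /andP[lam0 lam1] Phic PhiF.
split=> //; split=> //; split=> //.
exists (c2 / c1), (- ln lam); split; first by rewrite divr_gt0.
split; first by rewrite oppr_gt0 ln_lt0.
move=> d z Dd Xz0 zF t.
have Xz s : X (z s) by elim: s => [//|s IH]; rewrite zF; exact: XF.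
have Phit s : Phi (z s) <= lam ^+ s * Phi (z 0%N).
  elim: s => [|s IH]; first by rewrite expr0 mul1r.
  rewrite zF (le_trans (PhiF _ _ (Dd s) (Xz s)))// exprS -mulrA.
  by rewrite ler_wpM2l// ltW.
rewrite opprK expRM_natr lnK ?posrE//.
have /andP[lo _] := Phic _ (Xz t); have /andP[_ up] := Phic _ Xz0.
have -> : c2 / c1 * lam ^+ t * enorm (z 0%N - zs)
    = lam ^+ t * (c2 * enorm (z 0%N - zs)) / c1 by ring.
rewrite ler_pdivlMr// mulrC (le_trans lo)// (le_trans (Phit t))//.
by rewrite ler_wpM2l// exprn_ge0// ltW.
Qed.

(* [Phi] equals [U] on [A] and [2 * C + V] off [A]: the offset makes the jump
   from the second branch to the first a decrease by at least a half. *)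
Lemma switched_lyapunov_RGES (R : realType) l n (D : set 'cV[R]_l)
    (X : set 'cV[R]_n) (F : 'cV[R]_l -> 'cV[R]_n -> 'cV[R]_n) zs
    (A : pred 'cV[R]_n) (U V : 'cV[R]_n -> R) c1 c2 lam C Vm eta eps :
  (forall d z, D d -> X z -> X (F d z)) -> X zs ->
  (forall d, D d -> F d zs = zs) ->
  0 < c1 -> 0 < c2 -> 0 < lam < 1 -> 0 < C -> 0 < eta -> 0 < eps ->
  (forall z, X z -> c1 * enorm (z - zs) <= U z <= c2 * enorm (z - zs)) ->
  (forall z, X z -> U z <= C) ->
  (forall z, X z -> 0 <= V z <= Vm) ->
  (forall z, X z -> ~~ A z -> eps <= enorm (z - zs)) ->
  (forall d z, D d -> X z -> A z ->
     A (F d z) /\ U (F d z) <= lam * U z) ->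
  (forall d z, D d -> X z -> ~~ A z -> V (F d z) <= V z - eta) ->
  RGES D X F zs.
Proof.
move=> XF Xzs Fzs c1_gt0 c2_gt0 /andP[lam0 lam1] C0 eta0 eps0 Uc UC VVm epsA.
move=> FA FNA.
have Vm0 : 0 <= Vm by have /andP[] := VVm _ Xzs; exact: le_trans.
(* [T] bounds [Phi] off [A]. *)
pose T := 2 * C + Vm.
have T0 : 0 < T by rewrite /T; lra.
have U0 z : X z -> 0 <= U z.
  move=> /Uc/andP[+ _]; apply: le_trans.
  by rewrite mulr_ge0 ?enorm_ge0// ltW.
pose Phi z := if A z then U z else 2 * C + V z.
(* One rate per possible transition: [lam] inside [A], [2^-1] for entering [A], and [1 - eta / T]
   for staying outside, where losing [eta] out of at most [T] is a relative decrease. *)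
pose lam' := Num.max (Num.max lam 2^-1) (1 - eta / T).
have lam'1 : lam <= lam' by rewrite /lam' !le_max lexx.
have lam'2 : 2^-1 <= lam' by rewrite /lam' !le_max lexx orbT.
have lam'3 : 1 - eta / T <= lam' by rewrite /lam' !le_max lexx !orbT.
have etaT : 0 < eta / T by rewrite divr_gt0.
apply: (@lyapunov_RGES _ _ _ _ _ _ _ Phi c1 (Num.max c2 (T / eps)) lam') => //.
- by rewrite lt_max c2_gt0.
- rewrite (lt_le_trans lam0 lam'1)/= /lam' !gt_max lam1/=; apply/andP; split; lra.
- move=> z Xz; have /andP[lo up] := Uc _ Xz; have /andP[V0 V1] := VVm _ Xz.
  rewrite /Phi; case: ifPn => Az.
    rewrite lo (le_trans up)//.
    by rewrite ler_wpM2r ?enorm_ge0// le_max lexx.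
  have := UC _ Xz => UCz; apply/andP; split; first lra.
  apply: (@le_trans _ _ (T / eps * eps)).
    by rewrite divfK ?gt_eqF// /T lerD2l.
  apply: ler_pM; last exact: epsA.
  + by rewrite ltW// divr_gt0.
  + exact: ltW.
  + by rewrite le_max lexx orbT.
- move=> d z Dd Xz; have XFz := XF _ _ Dd Xz.
  have /andP[V0 V1] := VVm _ Xz; have /andP[FV0 FV1] := VVm _ XFz.
  (* The four transitions in order: inside to inside, outside to inside, inside to outside
     (impossible as [A] is invariant), outside to outside. *)
  rewrite /Phi; case: ifPn => AFz; case: ifPn => Az.
  + have [_ FU] := FA _ _ Dd Xz Az; apply: (le_trans FU).
    by rewrite ler_wpM2r// U0.
  + apply: (le_trans (UC _ XFz)).
    apply: (@le_trans _ _ (2^-1 * (2 * C + V z))); first lra.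
    by rewrite ler_wpM2r//; lra.
  + by have [] := FA _ _ Dd Xz Az; rewrite (negPf AFz).
  + have FVz := FNA _ _ Dd Xz Az.
    apply: (@le_trans _ _ ((1 - eta / T) * (2 * C + V z))); last first.
      by rewrite ler_wpM2r//; lra.
    have : eta / T * (2 * C + V z) <= eta.
      rewrite -[leRHS](divfK (lt0r_neq0 T0)) ler_wpM2l//; first exact: ltW.
      by rewrite /T lerD2l.
    lra.
Qed.

(** * Weighted excess and weighted distance to a reference point *)

Section WeightedDeviations.
Context {R : realType} {n : nat} (theta : R) (xs : 'cV[R]_n).
Implicit Types x : 'cV[R]_n.

Definition excess x := \sum_(i < n) theta ^+ i * Num.max 0 (x i 0 - xs i 0).

Definition wdist x := \sum_(i < n) theta ^+ i * `|x i 0 - xs i 0|.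

Hypothesis theta01 : 0 < theta <= 1.

Let weight_gt0 (i : nat) : 0 < theta ^+ i.
Proof. by rewrite exprn_gt0//; case/andP: theta01. Qed.

Let weight_le1 (i : nat) : theta ^+ i <= 1.
Proof. by have /andP[/ltW ? ?] := theta01; rewrite exprn_ile1. Qed.

Lemma excess_ge0 x : 0 <= excess x.
Proof.
by apply: sumr_ge0 => i _; rewrite mulr_ge0 ?le_max ?lexx// ltW.
Qed.

Lemma coord_excess_le x (i : 'I_n) :
  theta ^+ i * Num.max 0 (x i 0 - xs i 0) <= excess x.
Proof.
rewrite /excess (bigD1 i)//= lerDl; apply: sumr_ge0 => j _.
by rewrite mulr_ge0 ?le_max ?lexx// ltW.
Qed.

(** Ensures that a state of large excess also has large weighted content, the form in which the
    outflow bound is stated. *)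
Lemma excess_le_content x : (forall i, 0 <= x i 0) -> (forall i, 0 <= xs i 0) ->
  excess x <= \sum_(i < n) theta ^+ i * x i 0.
Proof.
move=> x0 xs0; apply: ler_sum => i _; rewrite ler_wpM2l ?(ltW (weight_gt0 _))//.
by rewrite ge_max x0 gerBl xs0.
Qed.

Lemma excess_le_wdist x : excess x <= wdist x.
Proof.
apply: ler_sum => i _; rewrite ler_wpM2l ?(ltW (weight_gt0 _))//.
by rewrite ge_max normr_ge0 ler_norm.
Qed.

Lemma wdist_le_enorm x : wdist x <= n%:R * enorm (x - xs).
Proof.
rewrite -[n in n%:R]card_ord -sum1_card natr_sum mulr_suml.
apply: ler_sum => i _; rewrite mul1r.
have := coord_le_enorm (x - xs) i; rewrite !mxE; apply: le_trans.
by rewrite ler_piMl.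
Qed.

Lemma enorm_le_wdist x : theta ^+ n * enorm (x - xs) <= wdist x.
Proof.
have /andP[th0 th1] := theta01.
rewrite (le_trans (ler_wpM2l (ltW (weight_gt0 n)) (enorm_le_sum _)))//.
rewrite mulr_sumr; apply: ler_sum => i _; rewrite !mxE ler_wpM2r//.
by rewrite ler_wiXn2l//; [exact: ltW|exact: ltnW].
Qed.

Lemma wdist_box (a : 'I_n -> R) x : box a xs -> box a x ->
  wdist x <= \sum_(i < n) a i.
Proof.
move=> axs ax; apply: ler_sum => i _; have /andP[x0 x1] := ax i.
have /andP[xs0 xs1] := axs i.
apply: (@le_trans _ _ `|x i 0 - xs i 0|); first by rewrite ler_piMl.
by rewrite ler_norml; lra.
Qed.

End WeightedDeviations.

(** * Slope estimates and uniform constants *)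

(** The slopes of [f] lie in [[L, 1]] and those of [id - f] in [[0, 1 - L]]. Both maps are therefore
    nondecreasing, their differences have the sign of [x - xs], and the one-sided bounds need only
    positive parts. *)
Lemma slope_gap (R : realType) (f : R -> R) (L c x xs : R) :
  0 <= L ->
  (forall y z, 0 <= y -> y <= z -> z <= c -> L * (z - y) <= f z - f y <= z - y) ->
  0 <= x <= c -> 0 <= xs <= c ->
  [/\ `|f x - f xs| <= `|x - xs|,
      f x - f xs <= Num.max 0 (x - xs),
      (x - xs) - (f x - f xs) <= (1 - L) * Num.max 0 (x - xs) &
      `|(x - xs) - (f x - f xs)| <= (1 - L) * `|x - xs| ].
Proof.
move=> L0 slope /andP[x0 xc] /andP[xs0 xsc].
have [xxs|/ltW xsx] := leP x xs.
  have := slope _ _ x0 xxs xsc => /andP[h1 h2].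
  have h3 : 0 <= L * (xs - x) by rewrite mulr_ge0 ?subr_ge0.
  rewrite max_l ?subr_le0// (ler0_norm (_ : x - xs <= 0)) ?subr_le0//.
  split; [rewrite ler_norml| | |rewrite ler_norml]; lra.
have := slope _ _ xs0 xsx xc => /andP[h1 h2].
have h3 : 0 <= L * (x - xs) by rewrite mulr_ge0 ?subr_ge0.
rewrite max_r ?subr_ge0// (ger0_norm (_ : 0 <= x - xs)) ?subr_ge0//.
split; [rewrite ler_norml| | |rewrite ler_norml]; lra.
Qed.

Lemma uniform_lower_bound (R : realType) n (P : 'I_n -> R -> Prop) :
  (forall i c c', P i c -> 0 < c' <= c -> P i c') ->
  (forall i, exists2 c, 0 < c & P i c) -> exists2 c, 0 < c & forall i, P i c.
Proof.
move=> Pmono exP.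
have /choice[c cP] : forall i, exists c, 0 < c /\ P i c.
  by move=> i; have [c] := exP i; exists c.
have sum0 : 0 <= \sum_(i < n) (c i)^-1.
  by apply: sumr_ge0 => i _; have [/ltW] := cP i; rewrite invr_ge0.
have sum1 : 0 < 1 + \sum_(i < n) (c i)^-1 by rewrite ltr_pwDl.
(* This number lies below every [c i] and is positive also for [n = 0], where a minimum over the
   indices would have no value. *)
exists (1 + \sum_(i < n) (c i)^-1)^-1; first by rewrite invr_gt0.
move=> i; have [ci0 Pc] := cP i; apply: (Pmono _ _ _ Pc).
rewrite invr_gt0 sum1/= invf_ple ?posrE// (bigD1 i)//= addrCA lerDl.
rewrite addr_ge0//; apply: sumr_ge0 => j _.
by have [/ltW] := cP j; rewrite invr_ge0.
Qed.

(** * Demand and supply bounds, invariance of the state set *)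

Section NetworkLemmas.
Context {R : realType} {l n : nat} (N : network R l n).
Implicit Types (d : 'cV[R]_l) (x v : 'cV[R]_n).

(** Monotonicity on [[0, delta i]] removes the absolute values; the upper slope bound comes from
    [G <= 1]. *)
Lemma demand_expansion (delta deltat : 'I_n -> R) :
  demand_assumption N delta deltat ->
  exists2 L : R, 0 < L < 1 &
    forall i d y z, unc N d -> 0 <= y -> y <= z -> z <= deltat i ->
      L * (z - y) <= demand N i d z - demand N i d y <= z - y.
Proof.
move=> hdemand.
have [] := @uniform_lower_bound R n (fun i c => c < 1 /\
    forall d y z, unc N d -> 0 <= y -> y <= z -> z <= deltat i ->
      c * (z - y) <= demand N i d z - demand N i d y <= z - y).
- move=> i c c' [c1 cP] /andP[c'0 c'c]; split=> [|d y z Dd y0 yz zd].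
    exact: le_lt_trans c1.
  have /andP[h1 ->] := cP d y z Dd y0 yz zd; rewrite andbT (le_trans _ h1)//.
  by rewrite ler_wpM2r// subr_ge0.
- move=> i; have [_ [_ [mono [/andP[dt0 dtd] [[L [/andP[L0 L1] LP]]]]]]] :=
    hdemand i.
  move=> [[G [/andP[G0 G1] GP]] _].
  exists L => //; split=> // d y z Dd y0 yz zd.
  have z0 : 0 <= z := le_trans y0 yz.
  have yd : y <= deltat i := le_trans yz zd.
  have f0 : 0 <= demand N i d z - demand N i d y.
    move: yz; rewrite le_eqVlt subr_ge0 => /predU1P[->//|yz].
    by rewrite ltW// (mono d Dd).2// (le_trans zd).
  have := LP d y z Dd; rewrite y0 yd z0 zd => /(_ isT isT).
  have := GP d y z Dd; rewrite y0 z0 (le_trans yd dtd) (le_trans zd dtd).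
  move=> /(_ isT isT).
  have yz0 : 0 <= z - y by rewrite subr_ge0.
  rewrite !(ger0_norm f0) !(ger0_norm yz0) => up ->; rewrite (le_trans up)//.
  by rewrite ler_piMl.
(* The bound [c < 1] is only known at an index [i], so for [n = 0] the constant has to be cut off at
   [2^-1]. *)
- move=> c c0 cP; exists (Num.min c 2^-1); last first.
    move=> i d y z Dd y0 yz zd.
    have /andP[h1 ->] := (cP i).2 d y z Dd y0 yz zd; rewrite andbT.
    rewrite (le_trans _ h1)// ler_wpM2r ?subr_ge0//.
    by rewrite ge_min lexx.
  by rewrite lt_min c0 gt_min invr_gt0 ltr0n invf_lt1 ?ltr1n ?orbT.
Qed.

Lemma demand_linear_lower_bound (delta deltat : 'I_n -> R) :
  demand_assumption N delta deltat ->
  exists2 k : R, 0 < k &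
    forall i d z, unc N d -> 0 <= z <= cap N i -> k * z <= demand N i d z.
Proof.
move=> hdemand.
apply: (@uniform_lower_bound R n (fun i k => forall d z, unc N d ->
  0 <= z <= cap N i -> k * z <= demand N i d z)).
  move=> i c c' cP /andP[c'0 c'c] d z Dd /[dup] zcap /andP[z0 _].
  by rewrite (le_trans _ (cP d z Dd zcap))// ler_wpM2r.
move=> i; have [_ [/andP[d0 dcap] [mono [/andP[dt0 dtd]]]]] := hdemand i.
move=> [[L [/andP[L0 L1] LP]] [_ [fmin [fmin0 fminP]]]].
have cap0 := cap_gt0 N i.
(* [m] bounds the demand from below on [[deltat i, cap N i]]: by monotonicity up to [delta i], by
   [fmin] beyond. On [[0, deltat i]] the slope [L] suffices, since [m / cap N i <= L]. *)
pose m := Num.min (L * deltat i) fmin.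
have m0 : 0 < m by rewrite lt_min fmin0 mulr_gt0.
exists (m / cap N i); first by rewrite divr_gt0.
move=> d z Dd /andP[z0 zcap].
have fb y : 0 <= y <= cap N i -> 0 <= demand N i d y <= y.
  exact: demand_bounds.
have f00 : demand N i d 0 = 0.
  by apply/le_anti; rewrite andbC; apply: fb; rewrite lexx ltW.
have lin y : 0 <= y <= deltat i -> L * y <= demand N i d y.
  move=> /andP[y0 yd].
  have := LP d 0 y Dd; rewrite lexx y0 yd (ltW dt0) => /(_ isT isT).
  rewrite f00 !subr0 (ger0_norm y0) ger0_norm//.
  suff /fb/andP[] : 0 <= y <= cap N i by [].
  by rewrite y0 (le_trans yd (le_trans dtd dcap)).
have mz : m / cap N i * z <= m.
  by rewrite mulrAC ler_pdivrMr// ler_wpM2l// ltW.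
have [zd|dz] := leP z (deltat i).
  apply: le_trans (lin z _); last by rewrite z0.
  rewrite ler_wpM2r// ler_pdivrMr//.
  apply: (@le_trans _ _ (L * deltat i)); first by rewrite ge_min lexx.
  by rewrite ler_wpM2l ?(ltW L0)// (le_trans dtd).
have [zd'|dz'] := leP z (delta i); last first.
  by rewrite (le_trans mz)// (le_trans _ (fminP d z Dd _)) ?(ltW dz')//
    ge_min lexx orbT.
rewrite (le_trans mz)//; apply: (@le_trans _ _ (demand N i d (deltat i))).
  by rewrite (le_trans _ (lin _ _)) ?ge_min ?lexx// ltW.
by rewrite ltW// (mono d Dd).2// ltW.
Qed.

(** The network data give this only for [x i 0 < cap N i]. A full cell is approached by draining it
    by [t], where the supply is at most [t]; continuity then gives supply at most [0]. *)
Lemma supply_le_residual i d x :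
  unc N d -> states N x -> supply N i d x <= cap N i - x i 0.
Proof.
move=> Dd Sx; have := Sx i => /andP[x0]; rewrite le_eqVlt => /predU1P[xi|xi].
  pose p (t : R) : 'cV[R]_l * 'cV[R]_n := (d, x - t *: delta_mx i 0).
  have pc : p t @[t --> (0 : R)] --> p 0.
    apply: (@cvg_pair _ _ _ _ (nbhs d) (nbhs (x - 0 *: delta_mx i 0))).
      exact: cvg_cst.
    apply: cvgB; first exact: cvg_cst.
    by apply: cvgZr_tmp; exact: cvg_id.
  have p0 : p 0 = (d, x) by rewrite /p scale0r subr0.
  have := @closure_within_le R _ _ _ p (fun t => t) (@supply_continuous _ _ _ N i).
  rewrite p0/= xi subrr; apply.
  - exact: pc.
  - exact: cvg_id.
  - by split.
  - near=> t.
    have t0 : 0 < t by [].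
    have ta : t <= cap N i.
      by near: t; apply: nbhs_right_le; exact: cap_gt0.
    have Sp : states N (x - t *: delta_mx i 0).
      move=> j; rewrite !mxE eqxx andbT; have := Sx j.
      case: eqP => [->|_]; last by rewrite mulr0 subr0.
      by move=> _; rewrite mulr1 xi subr_ge0 ta gerBl ltW.
    split=> //=.
    have := @supply_bounds _ _ _ N i d _ Dd Sp; rewrite !mxE !eqxx mulr1 xi.
    by rewrite gtrBl opprB addrCA subrr addr0 => /(_ t0) /andP[].
by have /andP[] := supply_bounds Dd Sx xi.
Unshelve. all: by end_near. Qed.

(** A cell releases at most its content, and its inflow is at most its supply, hence at most its
    free space. *)
Lemma network_step_states d x v :
  unc N d -> states N x -> nonneg v -> states N (network_step N d x v).
Proof.
move=> Dd Sx v0 i; rewrite mxE.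
have /andP[f0 fx] := demand_bounds Dd (Sx i).
have /andP[s0 s1] := sfun_bounds i Dd Sx v0.
have /andP[w0 w1] := wfun_bounds i Dd Sx v0.
have sf0 : 0 <= Defs.sfun N i d x v * demand N i d (x i 0) by rewrite mulr_ge0.
have sf1 : Defs.sfun N i d x v * demand N i d (x i 0) <= x i 0.
  by rewrite (le_trans _ fx)// ler_piMl.
have in0 : 0 <= \sum_(j < n) turn N j i * Defs.sfun N j d x v * demand N j d (x j 0).
  apply: sumr_ge0 => j _; have /andP[fj _] := demand_bounds Dd (Sx j).
  have /andP[sj _] := sfun_bounds j Dd Sx v0.
  by rewrite !mulr_ge0// turn_ge0.
have wv : 0 <= wfun N i d x v * v i 0 by rewrite mulr_ge0.
have := inflow_le_supply i Dd Sx v0; have := supply_le_residual i Dd Sx.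
by move=> h1 h2; apply/andP; split; lra.
Qed.

(** * Weighted downstream flow and the outflow bound *)

(** A nonzero entry in row [j] has [i > j], where the weight is at most [theta ^+ j.+1], and the row
    sums to at most [1]. *)
Lemma turn_weight (theta : R) j :
  strictly_upper_triangular (turn N) -> 0 <= theta <= 1 ->
  \sum_(i < n) turn N j i * theta ^+ i <= theta * theta ^+ j.
Proof.
move=> hturn /andP[th0 th1].
have tj : 0 <= theta * theta ^+ j by rewrite mulr_ge0 ?exprn_ge0.
apply: (@le_trans _ _ (\sum_(i < n) turn N j i * (theta * theta ^+ j))).
  apply: ler_sum => i _; have [ij|ji] := leqP i j.
    by rewrite hturn// !mul0r.
  rewrite ler_wpM2l ?turn_ge0// -exprS ler_wiXn2l//.
rewrite -mulr_suml ler_piMl//.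
by have := turn_exit N j; have := exitrate_ge0 N j; lra.
Qed.

Lemma turn_weighted_sum (theta : R) (y : 'I_n -> R) :
  strictly_upper_triangular (turn N) -> 0 <= theta <= 1 ->
  (forall j, 0 <= y j) ->
  \sum_(i < n) theta ^+ i * (\sum_(j < n) turn N j i * y j)
    <= theta * \sum_(j < n) theta ^+ j * y j.
Proof.
move=> hturn th01 y0.
under eq_bigr do rewrite mulr_sumr.
rewrite exchange_big/= mulr_sumr; apply: ler_sum => j _.
have := turn_weight j hturn th01 => /(ler_wpM2r (y0 j)).
rewrite mulr_suml mulrA; apply: le_trans; apply: ler_sum => i _.
by rewrite mulrA [_ * turn N j i]mulrC.
Qed.


(** [sfun] need not be continuous, so the minorant [st] is minimised over the compact set [K] of
    admissible triples. If all [st i * x i] vanish, the outflow assumption forces [x = 0], which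
    contradicts a content of at least [eps]. *)
Lemma outflow_lower_bound (vmax q : 'I_n -> R) vstar eps :
  outflow_assumption N vmax -> nonneg vstar ->
  (forall i, vstar i 0 < vmax i) -> 0 < eps ->
  exists2 m : R, 0 < m & forall d x v, unc N d -> states N x ->
    (forall i, 0 <= v i 0 <= vstar i 0) -> eps <= \sum_(i < n) q i * x i 0 ->
    m <= \sum_(i < n) Defs.sfun N i d x v * x i 0.
Proof.
move=> [vmax0 [st [stc [stb st0]]]] vs0 vsmax eps0.
pose K := (unc N `*` states N) `*` box (fun i => vstar i 0).
have cK : compact K.
  apply: compact_setX; last exact: compact_box.
  by apply: compact_setX; [exact: unc_compact|exact: compact_box].
have K0 : K !=set0.
  have [d Dd] := unc_neq0 N; exists (d, 0, 0); split; first split => //.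
    by move=> i /=; rewrite mxE lexx ltW// cap_gt0.
  by move=> i /=; rewrite mxE lexx vs0.
have KD d x v : unc N d -> states N x -> (forall i, 0 <= v i 0 <= vstar i 0) ->
    nonneg v by move=> _ _ vb i; have /andP[] := vb i.
pose y (p : 'cV[R]_l * 'cV[R]_n * 'cV[R]_n) :=
  \sum_(i < n) st i p.1.1 p.1.2 p.2 * p.1.2 i 0.
pose r (p : 'cV[R]_l * 'cV[R]_n * 'cV[R]_n) :=
  eps - \sum_(i < n) q i * p.1.2 i 0.
have xc i : {within K, continuous (fun p : 'cV[R]_l * 'cV[R]_n * 'cV[R]_n =>
    p.1.2 i 0)}.
  apply: continuous_subspaceT => p.
  apply: (@continuous_comp _ _ _ (fun p : 'cV[R]_l * 'cV[R]_n * 'cV[R]_n => p.1.2)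
    (fun M : 'cV[R]_n => M i 0)); last exact: coord_continuous.
  apply: (@continuous_comp _ _ _ fst snd); [exact: cvg_fst|exact: cvg_snd].
have yc : {within K, continuous y}.
  move=> p; apply: cvg_big => [|i _]; first exact: add_continuous.
  apply: cvgM; last exact: xc.
  apply: (@continuous_subspaceW _ _ _ ((unc N `*` states N) `*` nonneg)).
    by move=> [[d x] v] [[Dd Sx] vb]; split=> //; exact: KD Dd Sx vb.
  exact: stc.
have rc : {within K, continuous r}.
  move=> p; apply: cvgB; first exact: cvg_cst.
  apply: cvg_big => [|i _]; first exact: add_continuous.
  by apply: cvgM; [exact: cvg_cst|exact: xc].
(* The term [|r| + r] is a penalty, zero exactly when the content is at least [eps]. It replaces the
   restriction to that subset, which could be empty. *)
have fc : {within K, continuous (fun p => y p + (`|r p| + r p))}.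
  move=> p; apply: cvgD; first exact: yc.
  by apply: cvgD; [apply: cvg_norm; exact: rc|exact: rc].
have y_ge0 p : K p -> forall i, 0 <= st i p.1.1 p.1.2 p.2 * p.1.2 i 0.
  move=> [[Dd Sx] vb] i; have /andP[x0 _] := Sx i.
  have [/andP[s0 _] _] := stb i _ _ _ Dd Sx (KD _ _ _ Dd Sx vb).
  by rewrite mulr_ge0.
have [p /[!inE] Kp pmin] := compact_EVT_min K0 cK fc.
exists (y p + (`|r p| + r p)).
  have y0 : 0 <= y p by apply: sumr_ge0 => i _; exact: y_ge0.
  have r0 : 0 <= `|r p| + r p by rewrite -lerBlDr sub0r -normrN ler_norm.
  rewrite lt_neqAle addr_ge0// andbT eq_sym paddr_eq0//.
  apply/negP => /andP[/eqP yp0 /eqP rp0].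
  have x0 : p.1.2 = 0.
    case: p Kp yp0 {pmin y0 rp0 r0} => [[d x] v] Kp yp0.
    have [[/= Dd Sx] vb] := Kp.
    apply: (st0 _ _ _ Dd Sx (KD _ _ _ Dd Sx vb)) => i; split.
      rewrite mulrC; move: yp0 => /eqP; rewrite psumr_eq0 => [/allP|j _].
        by move=> /(_ i); rewrite mem_index_enum => /(_ isT) /eqP.
      exact: (y_ge0 _ Kp).
    by have /andP[_ /le_lt_trans] := vb i; apply; exact: vsmax.
  move: rp0; rewrite /r x0 big1 => [|i _]; last by rewrite mxE mulr0.
  by rewrite subr0 gtr0_norm//; lra.
move=> d x v Dd Sx vb epsV.
have Kdxv : K (d, x, v) by [].
have := pmin (d, x, v); rewrite inE => /(_ Kdxv) /le_trans; apply.
rewrite ler0_norm ?addNr ?addr0 /r/= ?subr_le0//.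
apply: ler_sum => i _; have /andP[x0 _] := Sx i.
have [_ ?] := stb i _ _ _ Dd Sx (KD _ _ _ Dd Sx vb).
by rewrite ler_wpM2r.
Qed.

(** * One-step estimates near the equilibrium and for the weighted content *)

(** Accommodation supplies the hypothesis of [uncongested], so all [wfun] and [sfun] equal [1]. *)
Lemma network_step_uncongested (deltat vmax mu : 'I_n -> R) d x v i :
  accommodation_assumption N deltat vmax mu ->
  unc N d -> states N x -> nonneg v ->
  (forall i, x i 0 <= mu i) -> (forall i, v i 0 <= vmax i) ->
  network_step N d x v i 0 =
    x i 0 + v i 0 - demand N i d (x i 0)
      + \sum_(j < n) turn N j i * demand N j d (x j 0).
Proof.
move=> [_ hacc] Dd Sx v0 xmu vmaxv.
have ws := uncongested Dd Sx v0 (fun j => le_trans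
  (lerD (vmaxv j) (lexx _)) (hacc d x Dd Sx xmu j)).
rewrite mxE (ws i).1 (ws i).2 !mul1r; congr (_ + _).
by apply: eq_bigr => j _; rewrite (ws j).2 mulr1.
Qed.

(** Each cell keeps the fraction [1 - 2 * theta], and routing returns at most [theta] of the
    weighted sum. *)
Lemma weighted_sum_contraction (theta : R) (y y' c : 'I_n -> R) :
  strictly_upper_triangular (turn N) -> 0 <= theta <= 1 ->
  (forall i, 0 <= y i) ->
  (forall i, y' i <= (1 - 2 * theta) * y i + c i
                       + \sum_(j < n) turn N j i * y j) ->
  \sum_(i < n) theta ^+ i * y' i
    <= (1 - theta) * (\sum_(i < n) theta ^+ i * y i)
         + \sum_(i < n) theta ^+ i * c i.
Proof.
move=> hturn th01 y0 y'y; have := turn_weighted_sum hturn th01 y0.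
have th0 : 0 <= theta by case/andP: th01.
have : \sum_(i < n) theta ^+ i * y' i
    <= (1 - 2 * theta) * (\sum_(i < n) theta ^+ i * y i)
         + \sum_(i < n) theta ^+ i * c i
         + \sum_(i < n) theta ^+ i * (\sum_(j < n) turn N j i * y j).
  rewrite mulr_sumr -!big_split/=; apply: ler_sum => i _.
  rewrite (le_trans (ler_wpM2l (exprn_ge0 i th0) (y'y i)))//.
  by rewrite !mulrDr mulrCA.
lra.
Qed.

(** At most the fraction [theta] of the weighted outflow reappears downstream, so at least
    [1 - theta] of it is lost. *)
Lemma weighted_content_step (theta : R) d x v :
  strictly_upper_triangular (turn N) -> 0 <= theta <= 1 ->
  unc N d -> states N x -> nonneg v ->
  \sum_(i < n) theta ^+ i * network_step N d x v i 0
    <= \sum_(i < n) theta ^+ i * x i 0 + \sum_(i < n) theta ^+ i * v i 0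
       - (1 - theta) * (\sum_(i < n) theta ^+ i *
                         (Defs.sfun N i d x v * demand N i d (x i 0))).
Proof.
move=> hturn th01 Dd Sx v0.
have th0 : 0 <= theta by case/andP: th01.
have sf0 i : 0 <= Defs.sfun N i d x v * demand N i d (x i 0).
  have /andP[s0 _] := sfun_bounds i Dd Sx v0.
  by have /andP[f0 _] := demand_bounds Dd (Sx i); rewrite mulr_ge0.
have := turn_weighted_sum hturn th01 sf0.
have : \sum_(i < n) theta ^+ i * network_step N d x v i 0
    <= \sum_(i < n) theta ^+ i * x i 0 + \sum_(i < n) theta ^+ i * v i 0
       - \sum_(i < n) theta ^+ i *
           (Defs.sfun N i d x v * demand N i d (x i 0))
       + \sum_(i < n) theta ^+ i * (\sum_(j < n) turn N j i *
           (Defs.sfun N j d x v * demand N j d (x j 0))).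
  rewrite -sumrN -!big_split/=; apply: ler_sum => i _.
  rewrite mxE -[- (theta ^+ i * _)]mulrN -!mulrDr ler_wpM2l ?exprn_ge0//.
  under [in leRHS]eq_bigr do rewrite mulrA.
  rewrite lerD2r lerD2r lerD2l ler_piMl//.
  by have /andP[_ ->] := wfun_bounds i Dd Sx v0.
lra.
Qed.

Lemma weighted_content_drop (theta k m : R) d x v :
  strictly_upper_triangular (turn N) -> 0 < theta <= 1 -> 0 < k ->
  (forall i d z, unc N d -> 0 <= z <= cap N i -> k * z <= demand N i d z) ->
  unc N d -> states N x -> nonneg v ->
  m <= \sum_(i < n) Defs.sfun N i d x v * x i 0 ->
  \sum_(i < n) theta ^+ i * network_step N d x v i 0
    <= \sum_(i < n) theta ^+ i * x i 0 + \sum_(i < n) theta ^+ i * v i 0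
       - (1 - theta) * (theta ^+ n * (k * m)).
Proof.
move=> hturn /andP[th0 th1] k0 hk Dd Sx v0 hm.
have thi (i : nat) : 0 < theta ^+ i by rewrite exprn_gt0.
have th01 : 0 <= theta <= 1 by rewrite ltW.
rewrite (le_trans (weighted_content_step hturn th01 Dd Sx v0))//.
rewrite lerD2l lerN2 ler_wpM2l ?subr_ge0//.
move: hm => /(ler_wpM2l (ltW k0)) /(ler_wpM2l (ltW (thi n))) /le_trans; apply.
rewrite !mulr_sumr; apply: ler_sum => i _.
have /andP[s0 _] := sfun_bounds i Dd Sx v0.
have /andP[x0 _] := Sx i.
apply: ler_pM; first exact: ltW.
- by rewrite !mulr_ge0// ltW.
- by rewrite ler_wiXn2l//; [exact: ltW|exact: ltnW].
- by rewrite mulrCA ler_wpM2l// hk.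
Qed.

(** Subtracting the equilibrium equation from the uncongested step leaves deviations to which
    [slope_gap] applies. Since [v <= vstar], the control error has a favourable sign for the excess
    and drops out there; in the distance it remains as an additive term. *)
Lemma local_step (theta : R) (deltat vmax mu : 'I_n -> R) d x v
    (xstar vstar : 'cV[R]_n) :
  strictly_upper_triangular (turn N) ->
  accommodation_assumption N deltat vmax mu ->
  0 < theta -> 2 * theta < 1 ->
  (forall i d y z, unc N d -> 0 <= y -> y <= z -> z <= deltat i ->
     2 * theta * (z - y) <= demand N i d z - demand N i d y <= z - y) ->
  unc N d -> states N xstar -> states N x ->
  (forall i, xstar i 0 <= mu i) -> (forall i, x i 0 <= mu i) ->
  (forall i, 0 <= v i 0 <= vstar i 0) -> (forall i, vstar i 0 <= vmax i) ->
  (forall i, demand N i d (xstar i 0)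
     = vstar i 0 + \sum_(j < n) turn N j i * demand N j d (xstar j 0)) ->
  excess theta xstar (network_step N d x v)
    <= (1 - theta) * excess theta xstar x /\
  wdist theta xstar (network_step N d x v)
    <= (1 - theta) * wdist theta xstar x
       + \sum_(i < n) theta ^+ i * (vstar i 0 - v i 0).
Proof.
move=> hturn haccom th0 th1 hslope Dd Sxs Sx xsmu xmu vb vsmax heq.
have th01 : 0 <= theta <= 1 by lra.
have v0 : nonneg v by move=> i; have /andP[] := vb i.
have vmaxv i : v i 0 <= vmax i by have /andP[_ /le_trans] := vb i; apply.
have mud i : mu i <= deltat i by have [/(_ i)/andP[_ /ltW mud] _] := haccom.
pose df j := demand N j d (x j 0) - demand N j d (xstar j 0).
have stepE i : network_step N d x v i 0 - xstar i 0 =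
    (x i 0 - xstar i 0) - df i + (v i 0 - vstar i 0)
    + \sum_(j < n) turn N j i * df j.
  rewrite (network_step_uncongested _ haccom Dd Sx v0)//.
  under [in RHS]eq_bigr do rewrite mulrBr.
  by rewrite sumrB /df (heq i); ring.
have gap i := @slope_gap _ (demand N i d) (2 * theta) (mu i) (x i 0) (xstar i 0).
have {}gap i : [/\ `|df i| <= `|x i 0 - xstar i 0|,
      df i <= Num.max 0 (x i 0 - xstar i 0),
      (x i 0 - xstar i 0) - df i
        <= (1 - 2 * theta) * Num.max 0 (x i 0 - xstar i 0) &
      `|(x i 0 - xstar i 0) - df i| <= (1 - 2 * theta) * `|x i 0 - xstar i 0|].
  have /andP[x0 _] := Sx i; have /andP[xs0 _] := Sxs i.
  apply: gap; rewrite ?x0 ?xs0 ?xmu ?xsmu//; first lra.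
  move=> y z y0 yz zmu; apply: hslope => //; exact: le_trans (mud i).
split.
  have -> : (1 - theta) * excess theta xstar x
      = (1 - theta) * excess theta xstar x + \sum_(i < n) theta ^+ i * 0.
    by rewrite big1 ?addr0// => i _; rewrite mulr0.
  apply: (@weighted_sum_contraction theta
    (fun i => Num.max 0 (x i 0 - xstar i 0))
    (fun i => Num.max 0 (network_step N d x v i 0 - xstar i 0)) (fun=> 0)) =>
    // i; first by rewrite le_max lexx.
  have p0 : 0 <= \sum_(j < n) turn N j i * Num.max 0 (x j 0 - xstar j 0).
    by apply: sumr_ge0 => j _; rewrite mulr_ge0 ?turn_ge0// le_max lexx.
  have p1 : 0 <= (1 - 2 * theta) * Num.max 0 (x i 0 - xstar i 0).
    by rewrite mulr_ge0 ?le_max ?lexx//; lra.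
  rewrite ge_max addr0 addr_ge0//= stepE.
  have [_ _ + _] := gap i; have /andP[_] := vb i.
  have : \sum_(j < n) turn N j i * df j <=
      \sum_(j < n) turn N j i * Num.max 0 (x j 0 - xstar j 0).
    apply: ler_sum => j _; rewrite ler_wpM2l ?turn_ge0//.
    by have [] := gap j.
  lra.
apply: (@weighted_sum_contraction theta (fun i => `|x i 0 - xstar i 0|)
  (fun i => `|network_step N d x v i 0 - xstar i 0|)) => // i.
rewrite stepE; have [_ _ _ h4] := gap i.
rewrite (le_trans (ler_normD _ _))// lerD//.
  rewrite (le_trans (ler_normD _ _))// lerD//.
  by rewrite ler0_norm ?opprB// subr_le0; have /andP[] := vb i.
rewrite (le_trans (ler_norm_sum _ _ _))//; apply: ler_sum => j _.
rewrite normrM ger0_norm ?turn_ge0// ler_wpM2l ?turn_ge0//.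
by have [] := gap j.
Qed.

End NetworkLemmas.

(** * The closed loop under the feedback law *)

Lemma feedbackE (R : realType) n (vstar b xstar : 'cV[R]_n) (K : 'M[R]_n) tau x
    i :
  feedback vstar b xstar K tau x i 0 = vstar i 0 - (vstar i 0 - b i 0) *
    (1 - Num.max 0 (1 - tau^-1 * \sum_(j < n) K i j *
                                  Num.max 0 (x j 0 - xstar j 0))).
Proof.
rewrite /feedback mul_diag_mx !mxE.
congr (_ - _ * (1 - Num.max _ (_ - _ * _))).
by apply: eq_bigr => j _; rewrite !mxE.
Qed.

Theorem theorem3p2 (R : realType) (l n : nat) (N : network R l n)
    (delta deltat vmax mu : 'I_n -> R)
    (hturn : strictly_upper_triangular (turn N))
    (hdemand : demand_assumption N delta deltat)
    (houtflow : outflow_assumption N vmax)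
    (haccom : accommodation_assumption N deltat vmax mu)
    (xstar vstar : 'cV[R]_n)
    (hxS : states N xstar)
    (hxmu : forall i : 'I_n, 0 < xstar i 0 < mu i)
    (hv0 : nonneg vstar)
    (hv : forall i : 'I_n,
       vstar i 0 < Num.min (vmax i) (inf [set supply N i d 0 | d in unc N]))
    (heq : forall (i : 'I_n) (d : 'cV[R]_l), unc N d ->
       demand N i d (xstar i 0)
       = vstar i 0 + \sum_(j < n) turn N j i * demand N j d (xstar j 0)) :
  exists (J : {set 'I_n}) (K : 'M[R]_n) (b : 'cV[R]_n),
    (forall i : 'I_n, i \in J -> 0 < vstar i 0) /\
    (forall i j : 'I_n, 0 <= K i j) /\
    nonneg b /\
    (forall i : 'I_n, i \in J -> 0 < b i 0 < vstar i 0) /\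
    (forall i : 'I_n, i \notin J -> b i 0 = vstar i 0) /\
    (forall tau : R, 0 < tau < 1 ->
       RGES (unc N) (states N)
            (closed_loop N (feedback vstar b xstar K tau)) xstar).
Proof.
have hvmax i : vstar i 0 < vmax i by have := hv i; rewrite lt_min => /andP[].
have [L /andP[L0 L1] hL] := demand_expansion hdemand.
have [k k0 hk] := demand_linear_lower_bound hdemand.
(* With slopes at least [2 * theta], the inflow share [theta] still leaves the contraction factor
   [1 - theta]. *)
pose theta := L / 2.
have LE : L = 2 * theta by rewrite /theta mulrC divfK.
have th0 : 0 < theta by rewrite divr_gt0.
have th1 : theta < 2^-1 by lra.
have th01 : 0 < theta <= 1 by lra.
have q0 (i : nat) : 0 < theta ^+ i by rewrite exprn_gt0.
(* The threshold is chosen so that [E x <= eps] forces [x <= mu] componentwise. *)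
have [eps eps0 heps] : exists2 eps : R, 0 < eps &
    forall i : 'I_n, eps <= theta ^+ i * (mu i - xstar i 0).
  apply: uniform_lower_bound => [i c c' cP /andP[_]|i].
    by move=> /le_trans; apply.
  exists (theta ^+ i * (mu i - xstar i 0)) => //.
  by rewrite mulr_gt0// subr_gt0; case/andP: (hxmu i).
have [m m0 hm] := @outflow_lower_bound _ _ _ N _ (fun i => theta ^+ i) _ _
  houtflow hv0 hvmax eps0.
(* Half of the guaranteed loss of content; the other half absorbs the remaining inflow [b]. *)
pose eta := (1 - theta) * (theta ^+ n * (k * m)) / 2.
have eta0 : 0 < eta by rewrite divr_gt0// !mulr_gt0//; lra.
pose sv := \sum_(i < n) theta ^+ i * vstar i 0.
have sv0 : 0 <= sv by apply: sumr_ge0 => i _; rewrite mulr_ge0// ltW.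
(* This gives [beta * sv <= eta] and [beta < 1]; the summand [2 * eta] keeps the denominator
   positive when [vstar = 0]. *)
pose beta := eta / (2 * eta + sv).
have den0 : 0 < 2 * eta + sv by lra.
have beta0 : 0 < beta by rewrite divr_gt0.
have beta1 : beta < 1 by rewrite ltr_pdivrMr// mul1r; lra.
have betasv : beta * sv <= eta.
  by rewrite mulrAC ler_pdivrMr// ler_wpM2l//; lra.
(* All rows of the gain matrix agree, so every component of [K h(x - xstar)] equals [E x / eps]. *)
exists [set i | 0 < vstar i 0]%SET, (\matrix_(i, j) (theta ^+ j / eps)),
  (beta *: vstar).
split; first by move=> i; rewrite inE.
split; first by move=> i j; rewrite mxE ltW// divr_gt0.
split; first by move=> i; rewrite mxE mulr_ge0// ltW.
split; first by move=> i; rewrite inE mxE => vi; rewrite mulr_gt0//= gtr_pMl.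
split.
  move=> i; rewrite inE -leNgt mxE => vi.
  have -> : vstar i 0 = 0 by apply: le_anti; rewrite vi hv0.
  by rewrite mulr0.
move=> tau /andP[tau0 tau1].
set fb := feedback _ _ _ _ _.
pose E := excess theta xstar; pose W := wdist theta xstar.
pose V (x : 'cV[R]_n) := \sum_(i < n) theta ^+ i * x i 0.
have E0 x : 0 <= E x := excess_ge0 xstar th01 x.
(* The common control effort: [g x] is the minimum of [1] and [E x / (tau * eps)]. *)
pose g x := 1 - Num.max 0 (1 - tau^-1 * (E x / eps)).
have fbE x i : fb x i 0 = vstar i 0 - (1 - beta) * vstar i 0 * g x.
  rewrite /fb feedbackE mxE -{2}[vstar i 0]mul1r -mulrBl.
  congr (_ - _ * (1 - Num.max _ (_ - _ * _))).
  by rewrite /E /excess mulr_suml; apply: eq_bigr => j _; rewrite mxE mulrAC.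
have g01 x : 0 <= g x <= 1.
  rewrite /g subr_ge0 ge_max ler01 gerBl lerBlDr lerDl le_max lexx !andbT/=.
  by rewrite mulr_ge0 ?divr_ge0 ?invr_ge0// ltW.
have gE x : g x <= E x / (tau * eps).
  have -> : E x / (tau * eps) = tau^-1 * (E x / eps) by rewrite invfM mulrCA.
  by rewrite /g lerBlDr -lerBlDl le_max lexx orbT.
have fbb x i : 0 <= fb x i 0 <= vstar i 0.
  rewrite fbE; have := hv0 i; have /andP[g0 g1] := g01 x; move=> v0.
  have bv : 0 <= (1 - beta) * vstar i 0 by rewrite mulr_ge0//; lra.
  have := ler_wpM2l bv g1; rewrite mulr1.
  have := mulr_ge0 bv g0; have := mulr_ge0 (ltW beta0) v0; lra.
have fb0 x : nonneg (fb x) by move=> i; have /andP[] := fbb x i.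
have muS i : xstar i 0 <= mu i by have /andP[_ /ltW] := hxmu i.
have EA x i : E x <= eps -> x i 0 <= mu i.
  move=> /(le_trans (coord_excess_le xstar th01 x i)).
  move=> /le_trans /(_ (heps i)).
  by rewrite ler_pM2l// ge_max lerD2r => /andP[].
(* The weighted inflow reduction is [(1 - beta) * sv * g x], hence at most [C * E x]. *)
pose C := sv / (tau * eps).
have C0 : 0 <= C by apply: divr_ge0 => //; rewrite mulr_ge0// ltW.
(* Chosen so that [C] is absorbed: [C + B * (1 - theta) = B * (1 - theta / 2)] *)
pose B := 2 * C / theta.
have B0 : 0 <= B by apply: divr_ge0; [rewrite mulr_ge0|exact: ltW].
have B1 : 0 <= 1 + B by rewrite addr_ge0.
pose U x := W x + B * E x.
have inA d x : unc N d -> states N x -> E x <= eps ->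
    E (closed_loop N fb d x) <= (1 - theta) * E x /\
    W (closed_loop N fb d x) <= (1 - theta) * W x + C * E x.
  move=> Dd Sx Ex.
  have [||? hW] := @local_step _ _ _ N theta _ _ _ d x (fb x) xstar vstar hturn
    haccom th0 _ _ Dd hxS Sx muS (EA x ^~ Ex) (fbb x) (fun i => ltW (hvmax i))
    (fun i => heq i d Dd); [lra|by rewrite -LE|].
  split=> //; rewrite (le_trans hW)// lerD2l /C mulrAC -mulrA mulr_suml.
  apply: ler_sum => i _; rewrite -mulrA ler_wpM2l//; first exact: ltW.
  rewrite fbE opprB addrC subrK.
  have v0 := hv0 i; have /andP[g0 g1] := g01 x.
  have := ler_wpM2l v0 (gE x); apply: le_trans.
  by rewrite -mulrA ler_piMl ?mulr_ge0//; lra.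
have offA d x : unc N d -> states N x -> eps < E x ->
    V (closed_loop N fb d x) <= V x - eta.
  move=> Dd Sx Ex.
  have EV : E x <= V x.
    apply: excess_le_content => // i; first by have /andP[] := Sx i.
    by have /andP[] := hxS i.
  (* As [tau < 1], the control is saturated above the threshold and the inflow is exactly [b]. *)
  have gx1 : g x = 1.
    rewrite /g max_l ?subr0// subr_le0 mulrC -ler_pdivrMr ?invr_gt0//.
    rewrite mul1r invrK ler_pdivlMr// (le_trans _ (ltW Ex))//.
    by rewrite ler_piMl ?ltW.
  have fbV : \sum_(i < n) theta ^+ i * fb x i 0 = beta * sv.
    rewrite /sv mulr_sumr; apply: eq_bigr => i _; rewrite fbE gx1; ring.
  have := weighted_content_drop hturn th01 k0 hk Dd Sx (fb0 x)
    (hm d x (fb x) Dd Sx (fbb x) (le_trans (ltW Ex) EV)).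
  have -> : (1 - theta) * (theta ^+ n * (k * m)) = 2 * eta.
    by rewrite [RHS]mulrC divfK.
  rewrite fbV -/(V x) -/(V (network_step N d x (fb x))) /closed_loop; lra.
pose cS := \sum_(i < n) cap N i.
have cS0 : 0 <= cS by apply: sumr_ge0 => i _; exact/ltW/cap_gt0.
have E_le_W x : E x <= W x := excess_le_wdist xstar th01 x.
have W_le x : W x <= n%:R * enorm (x - xstar) := wdist_le_enorm xstar th01 x.
(* Off the region [E x <= eps], the chain [eps < E x <= W x <= n * enorm (x - xstar)] bounds the
   distance from below. The added ones keep the constants positive when [n = 0]. *)
apply: (@switched_lyapunov_RGES _ _ _ _ _ _ _ (fun x => E x <= eps) U V
  (theta ^+ n) ((1 + B) * n%:R + 1) (1 - theta / 2) ((1 + B) * cS + 1) cS eta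
  (eps / (n%:R + 1))) => //.
- by move=> d z Dd Sz; exact: network_step_states.
(* The equilibrium property follows from the contraction estimate itself: at [xstar] both [E] and
   [W] vanish, so [W] vanishes after the step. *)
- move=> d Dd.
  have Exs : E xstar = 0.
    by rewrite /E /excess big1// => j _; rewrite subrr maxxx mulr0.
  have Wxs : W xstar = 0.
    by rewrite /W /wdist big1// => j _; rewrite subrr normr0 mulr0.
  have [|_] := inA d xstar Dd hxS; first by rewrite Exs ltW.
  rewrite Exs Wxs !mulr0 addr0.
  move=> /(le_trans (enorm_le_wdist xstar th01 _)).
  rewrite pmulr_rle0// => e0; apply/colP => i; apply/eqP.
  rewrite -subr_eq0 -normr_le0 (le_trans _ e0)//.
  by rewrite (le_trans _ (coord_le_enorm _ i))// !mxE.
- by rewrite ltr_wpDl// mulr_ge0.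
- by lra.
- by rewrite ltr_wpDl// mulr_ge0.
- by rewrite divr_gt0// ltr_wpDl.
- move=> x Sx; apply/andP; split.
    by rewrite (le_trans (enorm_le_wdist xstar th01 x))// lerDl mulr_ge0.
  have := ler_wpM2l B0 (E_le_W x); have := enorm_ge0 (x - xstar).
  have := ler_wpM2l B1 (W_le x); rewrite /U; lra.
- move=> x Sx; have := ler_wpM2l B0 (E_le_W x).
  have /(ler_wpM2l B1) : W x <= cS by exact: wdist_box.
  by rewrite /U; lra.
- move=> x Sx; apply/andP; split.
    by apply: sumr_ge0 => i _; have /andP[x0 _] := Sx i; rewrite mulr_ge0// ltW.
  apply: ler_sum => i _; have /andP[x0 x1] := Sx i.
  by rewrite (le_trans _ x1)// ler_piMl// exprn_ile1//; lra.
- move=> x Sx; rewrite -ltNge => Ex; have e0 := enorm_ge0 (x - xstar).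
  rewrite ler_pdivrMr ?ltr_wpDl// (le_trans (ltW Ex))//.
  rewrite (le_trans (E_le_W x))// (le_trans (W_le x))//.
  by rewrite mulrC ler_wpM2l// lerDl.
- move=> d x Dd Sx Ex; have [Es Ws] := inA d x Dd Sx Ex; split.
    by rewrite (le_trans Es)// (le_trans _ Ex)// ler_piMl//; lra.
  have BC : B * theta = 2 * C by rewrite /B divfK// gt_eqF.
  have W0 : 0 <= theta * W x.
    by rewrite mulr_ge0 ?(ltW th0)// (le_trans (E0 x)).
  have CE : C * E x = B * theta * E x / 2 by rewrite BC; field.
  have := ler_wpM2l B0 Es; move: Ws; rewrite /U CE; lra.
- by move=> d x Dd Sx; rewrite -ltNge; exact: offA.
Qed.
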